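(* Suppose $A_4(\alpha_0,\dots,\alpha_4)$ has a rational solution $(f_0,\dots,f_4)$ (indices modulo 5). Then: (1) if the solution is of Type A, then $\alpha_i\in\mathbb{Z}$ for all $0\le i\le4$; (2) if the solution is of Type B, then for some $i\in\{0,\dots,4\}$, $(\alpha_i,\alpha_{i+1},\alpha_{i+2},\alpha_{i+3},\alpha_{i+4})\equiv\left(\frac{n_1}3-\frac{n_3}3,\ \frac{n_1}3,\ \frac{n_1}3+\frac{n_4}3,\ \frac{n_3}3,\ -\frac{n_4}3\right)\pmod{\mathbb{Z}}$ for some $n_1,n_3,n_4\in\{0,1,2\}$; (3) if the solution is of Type C, then for some $i\in\{0,\dots,4\}$, $(\alpha_i,\alpha_{i+1},\alpha_{i+2},\alpha_{i+3},\alpha_{i+4})\equiv\left(\frac{n_1}5+\frac{2n_2}5+\frac{3n_3}5,\ \frac{n_1}5+\frac{2n_2}5+\frac{n_3}5,\ \frac{n_1}5,\ \frac{n_1}5+\frac{n_2}5,\ \frac{n_1}5+\frac{n_3}5\right)\pmod{\mathbb{Z}}$ for some $n_1,n_2,n_3\in\{0,1,2,3,4\}$.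
   Context: The $A_4^{(1)}$ Painlevé equation $A_4(\alpha_0,\dots,\alpha_4)$ with complex parameters $\alpha_j$ is the system for five functions $f_0,\dots,f_4$ of $t$ (indices in $\mathbb{Z}/5\mathbb{Z}$, ${}'=d/dt$): $f_j'=f_j(f_{j+1}-f_{j+2}+f_{j+3}-f_{j+4})+\alpha_j$ ($j=0,\dots,4$), $f_0+\dots+f_4=t$; hence $\sum_j\alpha_j=1$. A rational solution is a tuple of rational functions of $t$ satisfying it. Since $\sum f_j=t$, some $f_j$ has a pole at $t=\infty$, and (as shown in the paper) every rational solution is of exactly one of the following types: Type A(1) with index $i$: $f_i$ has a pole at $t=\infty$ and the other $f_j$ are regular there; Type A(2) with index $i$: $f_i,f_{i+1},f_{i+3}$ have a pole at $t=\infty$ and $f_{i+2},f_{i+4}$ are regular there; Type B with index $i$: $f_i,f_{i+1},f_{i+2}$ have a pole at $t=\infty$ and $f_{i+3},f_{i+4}$ are regular there; Type C: all $f_j$ have a pole at $t=\infty$. ''Type A'' means Type A(1) or Type A(2). *)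

(* Defs.v *)
From HB Require Import structures.
From mathcomp Require Import all_boot all_order all_algebra.
From mathcomp Require Import reals complex.
Set Implicit Arguments. Unset Strict Implicit. Unset Printing Implicit Defensive.
Import Order.TTheory GRing.Theory Num.Theory.
Local Open Scope ring_scope.
Notation "x %:F" := (@FracField.tofrac _ x) : ring_scope.

Section A4.
Variable C : fieldType.
Notation RF := {fraction {poly C}}.

Definition fnum (x : RF) : {poly C} := \n_(repr x).
Definition fden (x : RF) : {poly C} := \d_(repr x).

Definition rderiv (x : RF) : RF :=
  ((fnum x)^`() * fden x - fnum x * (fden x)^`())%:F / ((fden x) ^+ 2)%:F.

Definition pole_at_infty (x : RF) : Prop := (size (fden x) < size (fnum x))%N.

Definition rvar : RF := ('X)%:F.
Definition rconst (a : C) : RF := (a%:P)%:F.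

Definition sh (j : 'I_5) (k : nat) : 'I_5 := inZp (j + k).

Definition A4_rational_solution (alpha : 'I_5 -> C) (f : 'I_5 -> RF) : Prop :=
  (forall j : 'I_5,
     rderiv (f j) = f j * (f (sh j 1) - f (sh j 2) + f (sh j 3) - f (sh j 4))
                    + rconst (alpha j))
  /\ \sum_(j < 5) f j = rvar.

Definition typeA1 (f : 'I_5 -> RF) (i : 'I_5) : Prop :=
  pole_at_infty (f i) /\ forall j, j != i -> ~ pole_at_infty (f j).

Definition typeA2 (f : 'I_5 -> RF) (i : 'I_5) : Prop :=
  [/\ pole_at_infty (f i), pole_at_infty (f (sh i 1)), pole_at_infty (f (sh i 3)),
      ~ pole_at_infty (f (sh i 2)) & ~ pole_at_infty (f (sh i 4))].

Definition typeA (f : 'I_5 -> RF) : Prop := exists i, typeA1 f i \/ typeA2 f i.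

Definition typeB (f : 'I_5 -> RF) : Prop := exists i : 'I_5,
  [/\ pole_at_infty (f i), pole_at_infty (f (sh i 1)), pole_at_infty (f (sh i 2)),
      ~ pole_at_infty (f (sh i 3)) & ~ pole_at_infty (f (sh i 4))].

Definition typeC (f : 'I_5 -> RF) : Prop := forall j, pole_at_infty (f j).

Definition is_int (a : C) : Prop := exists z : int, a = z%:~R.
Definition congZ (a b : C) : Prop := exists z : int, a - b = z%:~R.

End A4.

(* Main.v *)
Require Import Defs.
From HB Require Import structures.
From mathcomp Require Import all_boot all_order all_algebra.
From mathcomp Require Import reals complex.
From mathcomp Require Import ring lra zify.
Import Order.TTheory GRing.Theory Num.Theory.
Local Open Scope ring_scope.
Local Open Scope complex_scope.

Set Implicit Arguments. Unset Strict Implicit. Unset Printing Implicit Defensive.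

(** Write A for the antisymmetric circulant matrix of the system, so that
    f_j' = f_j (A f)_j + alpha_j. At a finite point the leading coefficients r
    of the f_j satisfy sum r = 0 and, for every j, r_j = 0 or (A r)_j = e, where
    e = 0 at a pole of order at least 2 and e = -1 at a simple pole. Solving
    this for each support shows that all poles are simple, with residues in
    {0, 1, -1, 3, -3}. Hence f_j = a_j t + b_j + c_j / t + O(t^-2) at infinity,
    where c_j, the sum of the residues of f_j, is an integer. The terms of
    nonnegative degree of the equations give a_j (A a)_j = 0, then b = 0, and
    alpha_j = a_j - a_j (A c)_j - c_j (A a)_j. The type of the solution is the
    support of a, which determines a: its entries are integers for Type A,
    0 or 1/3 for Type B, and 1/5 for Type C. *)

(** * Index arithmetic modulo 5 and the circulant linear systems over an ordered field *)

Lemma sh_add (i : 'I_5) k l : sh (sh i k) l = sh i (k + l).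
Proof. by apply: val_inj; rewrite /= modnDml addnA. Qed.

Lemma sh_mod (i : 'I_5) k : sh i (k %% 5) = sh i k.
Proof. by apply: val_inj; rewrite /= modnDmr. Qed.

Lemma sh0 (i : 'I_5) : sh i 0 = i.
Proof. by apply: val_inj; rewrite /= addn0 modn_small. Qed.

Lemma sh_surj (i j : 'I_5) : exists2 k, (k < 5)%N & j = sh i k.
Proof.
exists ((j + (5 - i)) %% 5)%N; first exact: ltn_pmod.
apply: val_inj; rewrite /= modnDmr addnCA subnKC ?(ltnW (ltn_ord i)) //.
by rewrite modnDr modn_small.
Qed.

Lemma forall_sh (i : 'I_5) (Q : 'I_5 -> Prop) :
  Q i -> Q (sh i 1) -> Q (sh i 2) -> Q (sh i 3) -> Q (sh i 4) ->
  forall j, Q j.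
Proof.
move=> Q0 Q1 Q2 Q3 Q4 j; have [k lt_k5 ->] := sh_surj i j.
by case: k lt_k5 => [|[|[|[|[|]]]]] //; rewrite sh0.
Qed.

Lemma sum_sh (V : zmodType) (i : 'I_5) (g : 'I_5 -> V) :
  \sum_j g j = g i + g (sh i 1) + g (sh i 2) + g (sh i 3) + g (sh i 4).
Proof.
have shK : cancel (fun k : 'I_5 => sh i k) (fun j : 'I_5 => sh j (5 - i)).
  move=> k; rewrite sh_add; apply: val_inj => /=.
  by rewrite addnCA subnKC ?(ltnW (ltn_ord i)) // modnDr modn_small.
rewrite (reindex _ (onW_bij _ (injF_bij (can_inj shK)))) /=.
by rewrite !big_ord_recl big_ord0 addr0 !addrA /= sh0.
Qed.

(** Row j of the circulant matrix A applied to g. The values lie in an arbitrary additive group,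
    because A acts below on numbers, integers, polynomials and fractions alike. *)
Definition alt (V : zmodType) (g : 'I_5 -> V) (j : 'I_5) : V :=
  g (sh j 1) - g (sh j 2) + g (sh j 3) - g (sh j 4).

Lemma alt_sh (V : zmodType) (g : 'I_5 -> V) (i : 'I_5) :
  [/\ alt g (sh i 1) = g (sh i 2) - g (sh i 3) + g (sh i 4) - g i,
      alt g (sh i 2) = g (sh i 3) - g (sh i 4) + g i - g (sh i 1),
      alt g (sh i 3) = g (sh i 4) - g i + g (sh i 1) - g (sh i 2)
    & alt g (sh i 4) = g i - g (sh i 1) + g (sh i 2) - g (sh i 3)].
Proof.
by rewrite /alt !sh_add -(sh_mod i 5) -(sh_mod i 6) -(sh_mod i 7)
  -(sh_mod i 8) sh0.
Qed.

Lemma raddf_alt (U V : zmodType) (h : {additive U -> V}) (g : 'I_5 -> U) j :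
  h (alt g j) = alt (h \o g) j.
Proof. by rewrite /alt !(raddfB, raddfD). Qed.

Lemma eq_alt (V : zmodType) (g h : 'I_5 -> V) : g =1 h -> alt g =1 alt h.
Proof. by move=> gh j; rewrite /alt !gh. Qed.

Lemma altD (V : comPzRingType) (g h : 'I_5 -> V) j :
  alt (fun k => g k + h k) j = alt g j + alt h j.
Proof. by rewrite /alt; ring. Qed.

Lemma altM (V : pzRingType) (g : 'I_5 -> V) x j :
  alt (fun k => g k * x) j = alt g j * x.
Proof. by rewrite /alt !(mulrDl, mulNr). Qed.

(** Each of the 32 patterns s is a linear system in which linear arithmetic pins down one entry. The
    pattern is kept separate from g because g will be the real or imaginary part of a complex
    vector, and s the support of that vector. *)
Lemma alt_real_solutions (R : realFieldType) (s : 'I_5 -> bool) (e : R)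
    (g : 'I_5 -> R) :
  (forall j, if s j then alt g j = - e else g j = 0) -> \sum_j g j = 0 ->
  forall j, g j \in [:: 0; e; - e; 3 * e; - 3 * e].
Proof.
move=> gP sg i; move: (gP i) (gP (sh i 1)) (gP (sh i 2)) (gP (sh i 3)).
move: (gP (sh i 4)) sg; have [-> -> -> ->] := alt_sh g i.
rewrite (sum_sh i) {1}/alt !inE.
move: (g i) (g (sh i 1)) (g (sh i 2)) (g (sh i 3)) (g (sh i 4)).
move=> x0 x1 x2 x3 x4 {gP}.
case: (s i); case: (s (sh i 1)); case: (s (sh i 2)); case: (s (sh i 3));
  case: (s (sh i 4)) => h4 hs h0 h1 h2 h3;
  first [ have -> : x0 = 0 by lra
        | have -> : x0 = e by lra
        | have -> : x0 = - e by lra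
        | have -> : x0 = 3 * e by lra
        | have -> : x0 = - 3 * e by lra ]; by rewrite eqxx ?orbT.
Qed.

(** If g i and alt g i both vanished, each of the sixteen patterns at the other four indices would
    give a linear system incompatible with the sum 1. *)
Lemma alt_real_nondegenerate (R : realFieldType) (s : 'I_5 -> bool)
    (g : 'I_5 -> R) (i : 'I_5) :
  (forall j, if s j then alt g j = 0 else g j = 0) -> \sum_j g j = 1 ->
  g i = 0 -> alt g i <> 0.
Proof.
move=> gP sg; move: (gP (sh i 1)) (gP (sh i 2)) (gP (sh i 3)) (gP (sh i 4)) sg.
have [-> -> -> ->] := alt_sh g i; rewrite (sum_sh i) /alt.
move: (g i) (g (sh i 1)) (g (sh i 2)) (g (sh i 3)) (g (sh i 4)).
move=> x0 x1 x2 x3 x4 {gP}.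
by case: (s (sh i 1)); case: (s (sh i 2)); case: (s (sh i 3));
  case: (s (sh i 4)) => *; lra.
Qed.

(** * The circulant systems over the complex numbers *)

Section ComplexSystems.
Variable R : rcfType.
Local Notation Re := (@complex.Re _).
Local Notation Im := (@complex.Im _).
Implicit Types (g a b : 'I_5 -> R[i]).

(** [Rcomplex R] is [R[i]] regarded over R, the form in which [Re] and [Im] are additive maps. *)
Lemma Re_alt g j : Re (alt g j) = alt (Re \o g) j.
Proof. exact: (raddf_alt (@complex.Re R : {additive Rcomplex R -> R})). Qed.

Lemma Im_alt g j : Im (alt g j) = alt (Im \o g) j.
Proof. exact: (raddf_alt (@complex.Im R : {additive Rcomplex R -> R})). Qed.

Lemma Re_sum g : Re (\sum_j g j) = \sum_j (Re \o g) j.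
Proof. exact: (raddf_sum (@complex.Re R : {additive Rcomplex R -> R})). Qed.

Lemma Im_sum g : Im (\sum_j g j) = \sum_j (Im \o g) j.
Proof. exact: (raddf_sum (@complex.Im R : {additive Rcomplex R -> R})). Qed.

(** The right-hand sides are real, so the imaginary parts solve the system with e = 0 and vanish,
    while the real parts solve it with e itself. *)
Lemma alt_solutions (e : R) g :
  (forall j, g j = 0 \/ alt g j = (- e)%:C) -> \sum_j g j = 0 ->
  forall j, g j \in [seq x%:C | x <- [:: 0; e; - e; 3 * e; - 3 * e]].
Proof.
move=> gP sg j.
have reP := @alt_real_solutions R (fun k => g k != 0) e (Re \o g).
have imP := @alt_real_solutions R (fun k => g k != 0) 0 (Im \o g).
have Im0 : Im (g j) = 0.
  apply/eqP; have := imP _ _ j; rewrite !inE !(mulr0, oppr0) !orbb; apply.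
    move=> k; case: eqP => [/= -> //|g0] /=.
    by case: (gP k) => // gk; rewrite -Im_alt gk.
  by rewrite -Im_sum sg.
have -> : g j = (Re (g j))%:C
  by rewrite [LHS]complexE Im0 mulr0 addr0.
apply: map_f; apply: (reP _ _ j); last by rewrite -Re_sum sg.
move=> k; case: eqP => [/= -> //|g0] /=.
by case: (gP k) => // gk; rewrite -Re_alt gk.
Qed.

(** For e = 0 the list of possible values collapses to 0. This excludes multiple poles, growth
    faster than t at infinity, and constant terms in the expansion there. *)
Lemma alt_homogeneous g :
  (forall j, g j = 0 \/ alt g j = 0) -> \sum_j g j = 0 -> forall j, g j = 0.
Proof.
move=> gP sg j; have := @alt_solutions 0 g _ sg j.
rewrite !mulr0 !oppr0 !inE !orbb => g0; apply/eqP/g0 => k.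
by case: (gP k); auto.
Qed.

Lemma alt_integral g :
  (forall j, g j = 0 \/ alt g j = - 1) -> \sum_j g j = 0 ->
  forall j, is_int (g j).
Proof.
move=> gP sg j; have := @alt_solutions 1 g _ sg j; rewrite !inE !mulr1.
have int_real (z : int) : is_int ((z%:~R : R)%:C).
  by exists z; rewrite -[RHS](rmorph_int (real_complex R)).
case/(_ _)/or4P => [k|/eqP-> |/eqP-> |/eqP-> |/orP[]/eqP->].
- by rewrite rmorphN1.
- exact: (int_real 0).
- exact: (int_real 1).
- exact: (int_real (- 1)).
- exact: (int_real 3).
- exact: (int_real (- 3)).
Qed.

Lemma alt_nondegenerate a i :
  (forall j, a j * alt a j = 0) -> \sum_j a j = 1 -> a i = 0 -> alt a i != 0.
Proof.
move=> aP sa ai; apply/eqP => alti.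
have := @alt_real_nondegenerate R (fun k => a k != 0) (Re \o a) i.
rewrite -Re_alt alti /= ai => /(_ _ _ erefl erefl); apply.
  move=> k; case: eqP => [/= -> //|/eqP a0] /=.
  by have /eqP := aP k; rewrite mulf_eq0 (negPf a0) -Re_alt => /eqP ->.
by rewrite -Re_sum sa.
Qed.

(** Where a vanishes, the mixed equation is b j * alt a j = 0 with a nonzero second factor.
    Elsewhere alt a j = 0, so it reduces to alt b j = 0. Thus b solves the homogeneous system. *)
Lemma alt_perturbation a b :
  (forall j, a j * alt a j = 0) -> \sum_j a j = 1 ->
  (forall j, a j * alt b j + b j * alt a j = 0) -> \sum_j b j = 0 ->
  forall j, b j = 0.
Proof.
move=> aP sa abP; apply: alt_homogeneous => j.
have /eqP := abP j; have [aj|aj] := eqVneq (a j) 0.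
  rewrite aj mul0r add0r mulf_eq0 (negPf (alt_nondegenerate aP sa aj)) orbF.
  by move/eqP; left.
have /eqP := aP j; rewrite mulf_eq0 (negPf aj) => /eqP ->.
by rewrite mulr0 addr0 mulf_eq0 (negPf aj) => /eqP; right.
Qed.

End ComplexSystems.

(** * Derivative and pole at infinity computed from an arbitrary representative *)

Section RationalFunctions.
Variable F : fieldType.
Implicit Types (x : {fraction {poly F}}) (p q : {poly F}).

Lemma fden_neq0 x : fden x != 0.
Proof. exact: denom_ratioP. Qed.

Lemma mulr_fden x : x * (fden x)%:F = (fnum x)%:F.
Proof.
rewrite /fden /fnum -{1}[x]reprK; move: (repr x) => r.
unlock FracField.tofrac; rewrite -[LHS]FracField.pi_mul; apply/eqmodP.
rewrite /= FracField.equivfE /FracField.mulf.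
by rewrite !numden_Ratio ?mulr1 ?oner_neq0 ?mulr1 ?denom_ratioP // mulrC.
Qed.

Lemma fnum_fden_cross x p q : x * q%:F = p%:F -> fnum x * q = p * fden x.
Proof.
move=> xq; apply/eqP; rewrite -tofrac_eq !rmorphM /= -mulr_fden -xq.
by apply/eqP; ring.
Qed.

(** The quotient rule does not depend on the representative: differentiate the cross relation
    between p / q and the chosen one. *)
Lemma mulr_rderiv x p q : q != 0 -> x * q%:F = p%:F ->
  rderiv x * (q ^+ 2)%:F = (p^`() * q - p * q^`())%:F.
Proof.
move=> q0 /fnum_fden_cross xq; rewrite /rderiv mulrAC.
apply: (canLR (mulfK _)); first by rewrite tofrac_eq0 expf_neq0 ?fden_neq0.
rewrite -!rmorphM /=; congr (_%:F).
have := congr1 deriv xq; rewrite !derivM => dxq.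
(* This form involves the chosen numerator only through [fnum x * q] and its derivative, which the
   cross relation rewrites. *)
have -> : ((fnum x)^`() * fden x - fnum x * (fden x)^`()) * q ^+ 2 =
  ((fnum x)^`() * q + fnum x * q^`()) * fden x * q
  - (fnum x * q) * (fden x * q^`() + (fden x)^`() * q) by ring.
by rewrite dxq xq; ring.
Qed.

Lemma pole_at_inftyE x p q : q != 0 -> x * q%:F = p%:F ->
  pole_at_infty x <-> (size q < size p)%N.
Proof.
move=> q0 /fnum_fden_cross xq; rewrite /pole_at_infty.
have [p0|p0] := eqVneq p 0.
  move/eqP: xq; rewrite p0 mul0r mulf_eq0 (negPf q0) orbF => /eqP ->.
  by rewrite size_poly0.
have n0 : fnum x != 0.
  by apply: contraNneq p0 => n0; move/esym/eqP: xq;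
    rewrite n0 mul0r mulf_eq0 (negPf (fden_neq0 x)) orbF.
have /= := congr1 (fun r : {poly F} => size r) xq.
rewrite !size_mul ?fden_neq0 //.
move: n0 p0 q0 (fden_neq0 x); rewrite -!size_poly_gt0.
by move: (size (fnum x)) (size p) (size q) (size (fden x)) => *; lia.
Qed.

End RationalFunctions.

(** * Partial fractions with simple poles, and common denominators *)

Section PartialFractions.
Variable F : fieldType.
Implicit Types (s : seq F) (p q : {poly F}) (c : F -> F).

Local Notation prodX s := (\prod_(z <- s) ('X - z%:P)).

Lemma prodX_rem s x : x \in s -> prodX s = ('X - x%:P) * prodX (rem x s).
Proof. by move=> xs; rewrite (perm_big _ (perm_to_rem xs)) big_cons. Qed.

Lemma deriv_prodX_root s x : x \in s ->
  (prodX s)^`().[x] = (prodX (rem x s)).[x].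
Proof.
move=> xs; rewrite (prodX_rem xs) derivM derivXsubC mul1r.
by rewrite hornerD hornerM hornerXsubC subrr mul0r addr0.
Qed.

(** A repetition of x makes the derivative vanish at x. For the induction, at a root y of the tail
    the derivative of the whole product is y - x times that of the tail. *)
Lemma uniq_simple_roots s :
  (forall x, x \in s -> (prodX s)^`().[x] != 0) -> uniq s.
Proof.
elim: s => //= x s IHs simple; have xs : x \notin s.
  have := simple x (mem_head x s); rewrite deriv_prodX_root ?mem_head //=.
  by rewrite eqxx; apply: contra; rewrite -root_prod_XsubC.
rewrite xs; apply: IHs => y ys.
have := simple y; rewrite in_cons ys orbT => /(_ isT).
apply: contraNneq; rewrite big_cons derivM derivXsubC mul1r.
rewrite hornerD hornerM => ->; rewrite mulr0 addr0.
by rewrite -/(root _ _) root_prod_XsubC.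
Qed.

(* Lagrange interpolation: the proper part of p / prodX s has residue c x at x,
   hence expands at infinity as (\sum c x) / 'X + O('X^-2). *)
Lemma partial_fractions s p c : uniq s ->
  (forall x, x \in s -> p.[x] = c x * (prodX s)^`().[x]) ->
  exists w r t : {poly F},
    [/\ p = w * prodX s + r, 'X * r = (\sum_(x <- s) c x)%:P * prodX s + t,
        (size r <= size s)%N & (size t <= size s)%N].
Proof.
move=> us pc.
(* Numerator of the sum of d x / ('X - x) over the denominator [prodX s]. *)
pose comb d : {poly F} := \sum_(x <- s) d x *: prodX (rem x s).
have size_comb d : (size (comb d) <= size s)%N.
  rewrite /comb big_seq; elim/big_rec: _ => [|x q xs qs].
    by rewrite size_poly0.
  rewrite (leq_trans (size_polyD _ _)) // geq_max qs andbT.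
  rewrite (leq_trans (size_scale_leq _ _)) // size_prod_XsubC size_rem //.
  by case: (s) xs.
have rootr : all (root (p - comb c)) s.
  apply/allP => x xs; rewrite /root hornerD hornerN pc // horner_sum.
  rewrite [X in _ - X](bigD1_seq x) //= hornerZ deriv_prodX_root //.
  rewrite [X in _ - (_ + X)]big1_seq ?addr0 ?subrr //.
  move=> y /andP[yx ys]; rewrite hornerZ (_ : _.[x] = 0) ?mulr0 //.
  by apply/rootP; rewrite root_prod_XsubC mem_rem_uniq // inE eq_sym yx.
have [|w pw] := dvdpP _ _ (uniq_roots_dvdp rootr _).
  by rewrite uniq_rootsE.
(* The choice of t comes from 'X * c / ('X - x) = c + c * x / ('X - x). *)
exists w, (comb c), (comb (fun x => c x * x)); split=> //.
  by rewrite -pw subrK.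
rewrite rmorph_sum /= mulr_suml mulr_sumr -big_split /=.
rewrite big_seq [RHS]big_seq; apply: eq_bigr => x xs.
rewrite (prodX_rem xs) -!mul_polyC polyCM; ring.
Qed.

End PartialFractions.

(** The product of all denominators splits into linear factors; those dividing every numerator are
    cancelled one by one. Only joint reducedness is reached: at each root some numerator
    survives. *)
Lemma reduced_common_denominator (F : closedFieldType) (n : nat)
    (f : 'I_n -> {fraction {poly F}}) :
  exists (s : seq F) (P : 'I_n -> {poly F}),
    (forall j, f j * (\prod_(z <- s) ('X - z%:P))%:F = (P j)%:F)
    /\ (forall x, x \in s -> exists j, ~~ root (P j) x).
Proof.
have [s [P fP]] : exists (s : seq F) (P : 'I_n -> {poly F}),
    forall j, f j * (\prod_(z <- s) ('X - z%:P))%:F = (P j)%:F.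
  pose D := \prod_j fden (f j).
  have D0 : lead_coef D != 0.
    by rewrite lead_coef_eq0; apply/prodf_neq0 => j _; rewrite fden_neq0.
  have [s Ds] := closed_field_poly_normal D.
  exists s, (fun j => (lead_coef D)^-1 *:
                      (fnum (f j) * \prod_(k | k != j) fden (f k))) => j.
  have DE : D = fden (f j) * \prod_(k | k != j) fden (f k).
    by rewrite /D (bigD1 j).
  have -> : \prod_(z <- s) ('X - z%:P) = (lead_coef D)^-1%:P * D.
    by rewrite mul_polyC {2}Ds scalerA mulVf // scale1r.
  by rewrite -mul_polyC {2}DE !rmorphM /= -mulr_fden; ring.
elim: {s}(size s) {-2}s P (leqnn (size s)) fP => [|m IHm] s P.
  by rewrite leqn0 size_eq0 => /eqP-> fP; exists [::], P.
move=> le_sm fP; have [/hasP[x xs /forallP Px]|sP] :=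
  boolP (has (fun x => [forall j, root (P j) x]) s); last first.
  exists s, P; split=> // x xs; apply/existsP; rewrite -negb_forall.
  by apply: contra sP => Px; apply/hasP; exists x.
apply: (IHm (rem x s) (fun j => P j %/ ('X - x%:P))) => [|j].
  by rewrite size_rem //; case: (s) xs le_sm.
have X0 : ('X - x%:P)%:F != 0 by rewrite tofrac_eq0 polyXsubC_eq0.
apply: (mulIf X0); rewrite -mulrA -!rmorphM /= divpK ?dvdp_XsubCl //.
by rewrite -fP (prodX_rem xs) [X in _ = _ * X%:F]mulrC.
Qed.

Lemma mulf_eq0_or (F : idomainType) (x y : F) : x * y = 0 -> x = 0 \/ y = 0.
Proof. by move/eqP; rewrite mulf_eq0 => /orP[]/eqP; [left|right]. Qed.

(** * Degree bounds for polynomials *)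

Section PolyBounds.
Variable F : fieldType.
Implicit Types p q : {poly F}.

Lemma coefM_top p q m n : (size p <= m.+1)%N -> (size q <= n.+1)%N ->
  (p * q)`_(m + n) = p`_m * q`_n.
Proof.
move=> pm qn; have lt_m : (m < (m + n).+1)%N by rewrite ltnS leq_addr.
rewrite coefM (bigD1 (Ordinal lt_m)) //= addKn big1 ?addr0 // => i.
rewrite -val_eqE /= => i_m; have [lt_im|le_mi] := ltnP i m.
  by rewrite [q`__]nth_default ?mulr0 // (leq_trans qn) //; lia.
by rewrite [p`__]nth_default ?mul0r // (leq_trans pm) //; lia.
Qed.

(** A polynomial tending to 0 at infinity is 0. This is how terms of nonnegative degree are isolated
    after clearing the denominator q. *)
Lemma mulp_small_eq0 p q : (size (p * q)%R < size q)%N -> p = 0.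
Proof.
have [-> //|p0] := eqVneq p 0; have [->|q0] := eqVneq q 0.
  by rewrite mulr0 ltnn.
rewrite size_mul // => lt_q; move: p0; rewrite -size_poly_gt0 => p0.
by move: (size p) (size q) p0 lt_q => *; lia.
Qed.

Lemma size_polyM_bound p q m n : (size p <= m)%N -> (size q <= n)%N ->
  (size (p * q)%R <= (m + n).-1)%N.
Proof.
move=> pm qn; apply: leq_trans (size_polyMleq p q) _.
by rewrite -!subn1 leq_sub2r // leq_add.
Qed.

Lemma size_polyD_bound p q m : (size p <= m)%N -> (size q <= m)%N ->
  (size (p + q)%R <= m)%N.
Proof.
by move=> pm qm; rewrite (leq_trans (size_polyD _ _)) // geq_max pm.
Qed.

Lemma size_polyB_bound p q m : (size p <= m)%N -> (size q <= m)%N ->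
  (size (p - q)%R <= m)%N.
Proof. by move=> pm qm; apply: size_polyD_bound; rewrite ?size_polyN. Qed.

Lemma size_deriv_bound p m : (size p <= m)%N -> (size p^`() <= m.-1)%N.
Proof.
by move=> pm; rewrite (leq_trans (size_poly _ _)) // -!subn1 leq_sub2r.
Qed.

Lemma size_alt_bound (P : 'I_5 -> {poly F}) m j :
  (forall k, (size (P k) <= m)%N) -> (size (alt P j) <= m)%N.
Proof.
move=> Pm; apply: size_polyB_bound => //; apply: size_polyD_bound => //.
exact: size_polyB_bound.
Qed.

Lemma coef_alt (P : 'I_5 -> {poly F}) m j :
  (alt P j)`_m = alt (fun k => (P k)`_m) j.
Proof. by rewrite /alt !(coefB, coefD). Qed.

Lemma horner_alt (P : 'I_5 -> {poly F}) x j :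
  (alt P j).[x] = alt (fun k => (P k).[x]) j.
Proof. by rewrite /alt !(hornerD, hornerN). Qed.

Lemma polyC_alt (g : 'I_5 -> F) j : (alt g j)%:P = alt (fun k => (g k)%:P) j.
Proof. by rewrite /alt !(polyCD, polyCN). Qed.

End PolyBounds.

(** Here W = a X + b and V = aa X + ab are the polynomial parts of f_j and (A f)_j, c and ac their
    coefficients of 1 / X, and al the parameter. The identity moves everything of negative degree to
    the right-hand side. *)
Lemma expansion_identity (A : comPzRingType)
    (a b c al ac aa ab D D' W V Q Q' u v T X : A) :
  W = a * X + b -> V = aa * X + ab -> X * u = ac * D + v -> X * Q = c * D + T ->
  (a * D + W * D' + Q') * D - (W * D + Q) * D'
    = (W * D + Q) * (V * D + u) + al * (D * D) ->
  (a - a * ac - c * aa - al - W * V) * (D * D)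
    = (a * v + b * u + aa * T + ab * Q) * D + Q * D' - Q' * D + Q * u.
Proof.
move=> WE VE uE QE ode.
have -> : v = X * u - ac * D by rewrite uE; ring.
have -> : T = X * Q - c * D by rewrite QE; ring.
apply/subr0_eq; move/eqP: ode; rewrite -subr_eq0 => /eqP <-.
by rewrite WE VE; ring.
Qed.

(** * The system for f_j = P_j / D with denominators cleared: finite poles and growth *)

Section PolynomialSystem.
Variables (R : rcfType) (alpha : 'I_5 -> R[i]).
Variables (D : {poly R[i]}) (P : 'I_5 -> {poly R[i]}).
Hypothesis odeP : forall j,
  (P j)^`() * D - P j * D^`() = P j * alt P j + (alpha j)%:P * D ^+ 2.
Hypothesis sumP : \sum_j P j = 'X * D.

(** At a multiple root both D and D' vanish, so the values of the P k solve the homogeneous system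
    and are all 0, against joint reducedness. *)
Lemma root_simple x : root D x -> (exists j, ~~ root (P j) x) -> D^`().[x] != 0.
Proof.
move=> /rootP Dx [j Pjx]; apply: contra Pjx => /eqP D'x; apply/rootP.
apply: (alt_homogeneous (g := fun k => (P k).[x])) => [k|].
  apply: mulf_eq0_or.
  have := congr1 (fun p : {poly _} => p.[x]) (odeP k).
  rewrite /= [LHS]hornerD hornerN [RHS]hornerD !hornerM Dx D'x !mulr0 subrr.
  by rewrite addr0 horner_alt => /esym.
by rewrite -horner_sum sumP hornerM Dx mulr0.
Qed.

(** At a simple root the equation becomes - P_k D' = P_k (A P)_k, so the residues P_k / D' satisfy
    the system with e = 1. *)
Lemma residue_int x j : root D x -> D^`().[x] != 0 ->
  is_int ((P j).[x] / D^`().[x]).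
Proof.
move=> /rootP Dx D'x.
apply: (alt_integral (g := fun k => (P k).[x] / D^`().[x])) => [k|]; last first.
  by rewrite -mulr_suml -horner_sum sumP hornerM Dx mulr0 mul0r.
have [->|Pk] := eqVneq (P k).[x] 0; first by left; rewrite mul0r.
right; rewrite altM -horner_alt; apply: (canLR (mulfK D'x)); rewrite mulN1r.
have := congr1 (fun p : {poly _} => p.[x]) (odeP k).
rewrite /= [LHS]hornerD hornerN [RHS]hornerD !hornerM Dx !mulr0 add0r.
rewrite addr0 -mulrN.
by move/(mulfI Pk).
Qed.

(** If the degrees exceeded that of D by more than 1, the quadratic term would dominate and the top
    coefficients would solve the homogeneous system. The excess m is therefore lowered one step at a
    time. *)
Lemma size_numerator j : D != 0 -> (size (P j) <= (size D).+1)%N.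
Proof.
move=> D0; have [m Pm] : exists m, forall k, (size (P k) <= (size D).+1 + m)%N.
  exists (\max_k size (P k)) => k; apply: leq_trans (leq_addl _ _).
  exact: leq_bigmax.
elim: m Pm => [|m IHm] Pm; first by rewrite -(addn0 (size D).+1).
apply: IHm; pose d := ((size D).+1 + m)%N.
have {}Pm k : (size (P k) <= d.+1)%N by rewrite /d -addnS.
suff Pd : forall k, (P k)`_d = 0.
  move=> k; apply/leq_sizeP => i; rewrite leq_eqVlt => /orP[/eqP <- //|lt_di].
  by rewrite nth_default // (leq_trans (Pm k)).
apply: alt_homogeneous => [k|]; last first.
  rewrite -coef_sum sumP coefXM /d addSn /=.
  by rewrite nth_default // leq_addr.
apply: mulf_eq0_or.
(* In degree 2d only P_k (A P)_k can contribute. *)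
have := congr1 (fun p : {poly _} => p`_(d + d)) (odeP k).
rewrite /= [RHS]coefD (coefM_top (Pm k) (size_alt_bound k Pm)) coef_alt.
rewrite [LHS]nth_default; last first.
  apply: size_polyB_bound.
    apply: leq_trans (size_polyM_bound (size_deriv_bound (Pm k)) (leqnn _)) _.
    by rewrite /d; move: (size D) => n; lia.
  apply: leq_trans (size_polyM_bound (Pm k) (size_deriv_bound (leqnn _))) _.
  by rewrite /d; move: D0; rewrite -size_poly_gt0; move: (size D) => n; lia.
rewrite [X in _ = _ + X]nth_default ?addr0; last first.
  rewrite mul_polyC (leq_trans (size_scale_leq _ _)) // expr2.
  by apply: leq_trans (size_polyM_bound (leqnn _) (leqnn _)) _; rewrite /d;
  move: (size D) => n; lia.
by move/esym.
Qed.

(** * Expansion at infinity: P / D = W + Q / D, with Q / D = c / X + O(X^-2) *)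

Variables (N : nat) (W Q T : 'I_5 -> {poly R[i]}) (c : 'I_5 -> R[i]).
Hypothesis sizeD : size D = N.+1.
Hypothesis PE : forall j, P j = W j * D + Q j.
Hypothesis QE : forall j, 'X * Q j = (c j)%:P * D + T j.
Hypothesis sizeQ : forall j, (size (Q j) <= N)%N.
Hypothesis sizeT : forall j, (size (T j) <= N)%N.

Let a j := (W j)`_1.
Let b j := (W j)`_0.

Lemma D_neq0 : D != 0.
Proof. by rewrite -size_poly_gt0 sizeD. Qed.

Lemma quotientE j : W j = (a j)%:P * 'X + (b j)%:P.
Proof.
have [W0|W0] := eqVneq (W j) 0; first by rewrite /a /b W0 !coef0 mul0r addr0.
have : (size (W j * D)%R <= N.+2)%N.
  rewrite -[_ * _](addrK (Q j)) -PE size_polyB_bound //.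
    by rewrite -sizeD size_numerator ?D_neq0.
  by rewrite (leq_trans (sizeQ j)) // leqW.
rewrite size_mul ?D_neq0 // sizeD addnS /= -(addn2 N) addnC leq_add2l => sizeW.
apply/polyP => -[|[|i]]; rewrite coefD coefMX !coefC /= ?add0r ?addr0 //.
by rewrite nth_default // (leq_trans sizeW).
Qed.

(** Uniqueness of Euclidean division by D, applied to [sumP]. *)
Lemma sum_quotient : \sum_j W j = 'X /\ \sum_j Q j = 0.
Proof.
have E : (\sum_j W j - 'X) * D = - \sum_j Q j.
  have SP : \sum_j P j = (\sum_j W j) * D + \sum_j Q j.
    by rewrite mulr_suml -big_split /=; apply: eq_bigr.
  by rewrite mulrBl -sumP SP opprD addNKr.
have sizeS : (size (\sum_j Q j)%R <= N)%N.
  by elim/big_rec: _ => [|j q _ qN]; rewrite ?size_poly0 ?size_polyD_bound.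
have W0 : \sum_j W j - 'X = 0.
  by apply: (@mulp_small_eq0 _ _ D); rewrite E size_polyN sizeD ltnS.
split; first exact/subr0_eq.
by apply/oppr_inj; rewrite oppr0 -E W0 mul0r.
Qed.

Lemma sum_a : \sum_j a j = 1.
Proof. by rewrite -coef_sum (sum_quotient.1) coefX. Qed.

Lemma sum_b : \sum_j b j = 0.
Proof. by rewrite -coef_sum (sum_quotient.1) coefX. Qed.

Lemma sum_c : \sum_j c j = 0.
Proof.
have E : (\sum_j c j)%:P * D = - \sum_j T j.
  apply/eqP; rewrite -addr_eq0 rmorph_sum /= mulr_suml -big_split /=.
  rewrite -(eq_bigr _ (fun j _ => QE j)) -mulr_sumr (sum_quotient.2).
  by rewrite mulr0.
apply/eqP; rewrite -polyC_eq0; apply/eqP/(@mulp_small_eq0 _ _ D).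
rewrite E size_polyN sizeD ltnS.
by elim/big_rec: _ => [|j q _ qN]; rewrite ?size_poly0 ?size_polyD_bound.
Qed.

(* These are the terms of nonnegative degree of the equation at infinity. *)
Lemma expansion_at_infinity j :
  (a j - a j * alt c j - c j * alt a j - alpha j)%:P = W j * alt W j.
Proof.
(* Multiplied by D^2, the difference of the two sides is a sum of products of size at most 2N, while
   D^2 has size 2N + 1. *)
apply/subr0_eq/(@mulp_small_eq0 _ _ (D ^+ 2)); rewrite expr2.
set u := alt Q j; set v := alt T j.
have uE : 'X * u = (alt c j)%:P * D + v.
  rewrite /u /v polyC_alt -altM -altD mulrC -altM; apply: eq_alt => k.
  by rewrite mulrC QE.
have altWE : alt W j = (alt a j)%:P * 'X + (alt b j)%:P.
  rewrite !polyC_alt -altM -altD; apply: eq_alt => k; exact: quotientE.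
have altPE : alt P j = alt W j * D + u.
  by rewrite -altM -altD; apply: eq_alt => k; rewrite PE.
have W' : (W j)^`() = (a j)%:P.
  by rewrite quotientE derivD derivM !derivC derivX mul0r mulr1 addr0 add0r.
have := odeP j; rewrite altPE PE derivD derivM W' expr2 => ode.
rewrite 3!polyCB 2!polyCM.
rewrite (expansion_identity (quotientE j) altWE uE (QE j) ode).
have sizeQalt : (size u <= N)%N by exact: size_alt_bound.
have sizeTalt : (size v <= N)%N by exact: size_alt_bound.
have sizeC (z : R[i]) (p : {poly R[i]}) :
    (size p <= N)%N -> (size (z%:P * p)%R <= N)%N.
  by move=> pN; rewrite mul_polyC (leq_trans (size_scale_leq _ _)).
have sizeM (p q : {poly R[i]}) : (size p <= N)%N -> (size q <= N.+1)%N ->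
    (size (p * q)%R <= N + N)%N.
  by move=> pN qN; have := size_polyM_bound pN qN; rewrite addnS.
rewrite size_mul ?D_neq0 // sizeD addnS addSn ltnS.
apply: size_polyD_bound; last by apply: sizeM => //; exact: leqW.
apply: size_polyB_bound; last first.
  apply: sizeM; last by rewrite sizeD.
  by rewrite (leq_trans (size_deriv_bound (sizeQ j))) // leq_pred.
apply: size_polyD_bound; last first.
  by apply: sizeM; rewrite // (leq_trans (size_deriv_bound (leqnn _))) // sizeD.
apply: sizeM; last by rewrite sizeD.
by do 3?apply: size_polyD_bound; apply: sizeC.
Qed.

(** The product of the affine polynomials W j and alt W j equals a constant; compare the
    coefficients of X^2, X and 1. *)
Lemma expansion_coefficients j :
  [/\ a j * alt a j = 0, a j * alt b j + b j * alt a j = 0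
    & alpha j = a j - a j * alt c j - c j * alt a j - b j * alt b j].
Proof.
have := expansion_at_infinity j.
have -> : W j * alt W j = (a j * alt a j)%:P * 'X^2
    + (a j * alt b j + b j * alt a j)%:P * 'X + (b j * alt b j)%:P.
  have -> : alt W j = (alt a j)%:P * 'X + (alt b j)%:P.
    by rewrite !polyC_alt -altM -altD; apply: eq_alt => k; exact: quotientE.
  by rewrite quotientE (polyCD (a j * alt b j)) !polyCM; ring.
set e := (X in X%:P = _) => /polyP E.
have := E 2%N; have := E 1%N; have := E 0%N.
rewrite !(coefD, coefCM, coefXn, coefX, coefC) /=.
rewrite !(mulr0, mulr1, add0r, addr0) => <- <- <-.
by split=> //; rewrite /e; ring.
Qed.

Lemma b_eq0 j : b j = 0.
Proof.
apply: (@alt_perturbation _ a b) j; rewrite ?sum_a ?sum_b // => j;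
  by case: (expansion_coefficients j).
Qed.

Lemma alpha_expansion j : alpha j = a j - a j * alt c j - c j * alt a j.
Proof.
by have [_ _ ->] := expansion_coefficients j; rewrite b_eq0 mul0r subr0.
Qed.

(** This identifies the set of poles at infinity with the support of a. *)
Lemma numerator_dominates j : (size D < size (P j))%N = (a j != 0).
Proof.
rewrite PE quotientE b_eq0 addr0; have [->|a0] := eqVneq (a j) 0.
  by rewrite !mul0r add0r sizeD; apply/negbTE; rewrite -leqNgt leqW.
have sizeaX : size ((a j)%:P * 'X * D) = N.+2.
  by rewrite -mulrA mul_polyC size_scale // size_mul ?polyX_eq0 ?D_neq0 //
    size_polyX sizeD.
by rewrite sizeD size_polyDl sizeaX ?ltnSn // !ltnS (leq_trans (sizeQ j)).
Qed.

End PolynomialSystem.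

(** * Asymptotics of a rational solution, with integral coefficients of 1 / t *)

Lemma is_int_sum (F : fieldType) (s : seq F) (g : F -> F) :
  (forall x, x \in s -> is_int (g x)) -> is_int (\sum_(x <- s) g x).
Proof.
move=> gP; rewrite big_seq; apply: (big_ind (@is_int F)) => //.
  by exists 0.
by move=> _ _ [y ->] [z ->]; exists (y + z); rewrite rmorphD.
Qed.

(* Here [f j] expands at infinity as [a j * t + z j / t + O(t^-2)]. *)
Lemma A4_asymptotics (R : rcfType) (alpha : 'I_5 -> R[i])
    (f : 'I_5 -> {fraction {poly R[i]}}) :
  A4_rational_solution alpha f ->
  exists (a : 'I_5 -> R[i]) (z : 'I_5 -> int),
    [/\ \sum_j a j = 1, forall j, a j * alt a j = 0, \sum_j z j = 0,
        forall j, alpha j = a j - a j * (alt z j)%:~R - (z j)%:~R * alt a j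
      & forall j, pole_at_infty (f j) <-> a j != 0].
Proof.
move=> [odef sumf]; have [s [P [fP coprP]]] := reduced_common_denominator f.
pose D : {poly R[i]} := \prod_(x <- s) ('X - x%:P).
have D0 : D != 0 by rewrite monic_neq0 // monic_prod_XsubC.
have DF0 : D%:F != 0 by rewrite tofrac_eq0.
have odeP j :
    (P j)^`() * D - P j * D^`() = P j * alt P j + (alpha j)%:P * D ^+ 2.
  apply/eqP; rewrite -tofrac_eq -(mulr_rderiv D0 (fP j)) odef; apply/eqP.
  have altf : alt f j * D%:F = (alt P j)%:F.
    rewrite -altM (raddf_alt (@FracField.tofrac {poly R[i]})).
    exact: eq_alt.
  rewrite rmorphD !(rmorphXn, rmorphM) /= -altf -fP -/D /rconst /alt; ring.
have sumP : \sum_j P j = 'X * D.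
  apply/eqP; rewrite -tofrac_eq rmorphM /= -/(rvar _) -sumf rmorph_sum.
  rewrite mulr_suml.
  by apply/eqP/eq_bigr => j _; rewrite fP.
have rootD x : x \in s -> root D x by rewrite root_prod_XsubC.
have simpleD x : x \in s -> D^`().[x] != 0.
  by move=> xs; apply: (root_simple odeP sumP); [exact: rootD|exact: coprP].
have us : uniq s by apply: uniq_simple_roots.
pose res j x := (P j).[x] / D^`().[x].
have Ps j x : x \in s -> (P j).[x] = res j x * D^`().[x].
  by move=> xs; rewrite divfK ?simpleD.
have [W] := fin_all_exists (fun j => partial_fractions us (@Ps j)).
move=> /fin_all_exists[Q] /fin_all_exists[T] /all_and4[PE QE sizeQ sizeT].
have /fin_all_exists[z zE] j : exists z : int, \sum_(x <- s) res j x = z%:~R.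
  apply: is_int_sum => x xs.
  exact: (residue_int odeP sumP j (rootD x xs) (simpleD x xs)).
have sizeD : size D = (size s).+1 by rewrite size_prod_XsubC.
pose c j : R[i] := (z j)%:~R.
have {}QE j : 'X * Q j = (c j)%:P * D + T j by rewrite QE zE.
exists (fun j => (W j)`_1), z; split.
- exact: (sum_a sumP sizeD PE sizeQ).
- move=> j.
  by case: (expansion_coefficients odeP sumP sizeD PE QE sizeQ sizeT j).
- by apply/eqP; rewrite -(intr_eq0 R[i]) rmorph_sum /= (sum_c sumP sizeD PE QE).
- move=> j; rewrite (alpha_expansion odeP sumP sizeD PE QE sizeQ sizeT j).
  by rewrite (raddf_alt (intmul 1 : {additive int -> R[i]})).
- move=> j; rewrite -(numerator_dominates odeP sumP sizeD PE QE sizeQ sizeT j).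
  exact: pole_at_inftyE D0 (fP j).
Qed.

(** The division is stated in F, so that replacing the remainder n leaves identities that [field]
    can check. *)
Lemma int_residue (F : pzRingType) (d : nat) (m : int) :
  exists (n : 'I_d.+1) (q : int), n%:R = m%:~R - d.+1%:R * q%:~R :> F.
Proof.
have lt_md : (`|(m %% d.+1)%Z| < d.+1)%N.
  by rewrite -ltz_nat gez0_abs ?modz_ge0 // ltz_pmod.
exists (Ordinal lt_md), (m %/ d.+1)%Z.
rewrite /= pmulrn gez0_abs ?modz_ge0 //; apply/eqP.
rewrite eq_sym subr_eq {1}(divz_eq m d.+1) rmorphD rmorphM /= addrC.
by rewrite -[d.+1%:R]/(d.+1%:~R) -!intrM mulrC.
Qed.

(** * Leading coefficients and parameters for each type *)

Section Types.
Variables (F : numFieldType) (alpha a : 'I_5 -> F) (z : 'I_5 -> int).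
Hypothesis sum_a : \sum_j a j = 1.
Hypothesis aP : forall j, a j * alt a j = 0.
Hypothesis sum_z : \sum_j z j = 0.
Hypothesis alphaE :
  forall j, alpha j = a j - a j * (alt z j)%:~R - (z j)%:~R * alt a j.

Lemma alt_a_eq0 j : a j != 0 -> alt a j = 0.
Proof. by have /eqP := aP j; rewrite mulf_eq0 => /orP[->|/eqP]. Qed.

Lemma alpha_int : (forall j, is_int (a j)) -> forall j, is_int (alpha j).
Proof.
move=> /fin_all_exists[m aE] j.
exists (m j - m j * alt z j - z j * alt m j); rewrite alphaE.
have -> : alt a j = (alt m j)%:~R.
  by rewrite (raddf_alt (intmul 1 : {additive int -> F})); apply: eq_alt.
by rewrite !(rmorphB, rmorphM) /= aE.
Qed.

Lemma typeA1_int i : (forall j, j != i -> a j = 0) -> forall j, is_int (a j).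
Proof.
move=> a0 j; have [->|/a0 ->] := eqVneq j i; last by exists 0.
by exists 1; rewrite -sum_a (bigD1 i) //= big1 ?addr0.
Qed.

(** The rows of A on the support, together with the sum 1, force the values 1, 1, -1 at i, i + 1, i
    + 3. *)
Lemma typeA2_int i : a i != 0 -> a (sh i 1) != 0 -> a (sh i 3) != 0 ->
  a (sh i 2) = 0 -> a (sh i 4) = 0 -> forall j, is_int (a j).
Proof.
move=> /alt_a_eq0 e0 /alt_a_eq0 e1 /alt_a_eq0 e3 a2 a4.
have [E1 _ E3 _] := alt_sh a i; move: e0 e1 e3 sum_a.
rewrite E1 E3 (sum_sh i) /alt a2 a4 !(addr0, subr0, sub0r) => e0 e1 e3 s.
have a0 : a i = 1 by rewrite -s -[LHS]addr0 -e0; ring.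
have a1 : a (sh i 1) = 1 by rewrite -a0 -[RHS]addr0 -e3; ring.
have a3 : a (sh i 3) = - 1 by rewrite -a0 -[RHS]subr0 -e1; ring.
apply: (@forall_sh i); rewrite ?(a0, a1, a2, a3, a4); try by exists 0.
- by exists 1.
- by exists 1.
- by exists (- 1).
Qed.

Lemma typeB_values i : a i != 0 -> a (sh i 1) != 0 -> a (sh i 3) = 0 ->
  a (sh i 4) = 0 ->
  [/\ a i = 3^-1, a (sh i 1) = 3^-1 & a (sh i 2) = 3^-1].
Proof.
move=> /alt_a_eq0 e0 /alt_a_eq0 e1 a3 a4; have [E1 _ _ _] := alt_sh a i.
move: e0 e1 sum_a; rewrite E1 (sum_sh i) /alt a3 a4 !(addr0, subr0) => e0 e1 s.
have a1 : a (sh i 1) = a (sh i 2) by apply/subr0_eq.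
have a2 : a (sh i 2) = a i by apply/subr0_eq.
suff a0 : a i = 3^-1 by rewrite a1 a2 a0.
rewrite -[RHS]mul1r; apply: (canRL (mulfK _)); first by rewrite pnatr_eq0.
by rewrite -[RHS]s a1 a2; ring.
Qed.

Lemma typeC_values : (forall j, a j != 0) -> forall j, a j = 5^-1.
Proof.
move=> a0 i; have e j := alt_a_eq0 (a0 j).
(* Rows j and j + 1 of A add up to the difference of the entries j + 1 and j. *)
have step j : a (sh j 1) = a j.
  apply/subr0_eq; rewrite -[RHS](addr0 0) -{1}(e j) -(e (sh j 1)).
  by have [-> _ _ _] := alt_sh a j; rewrite /alt; ring.
have s2 : a (sh i 2) = a i by rewrite -(sh_add i 1 1) !step.
have s3 : a (sh i 3) = a i by rewrite -(sh_add i 2 1) step.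
have s4 : a (sh i 4) = a i by rewrite -(sh_add i 3 1) step.
rewrite -[RHS]mul1r; apply: (canRL (mulfK _)); first by rewrite pnatr_eq0.
by rewrite -[RHS]sum_a (sum_sh i) s2 s3 s4 step; ring.
Qed.

Lemma typeB_congruences i : a i = 3^-1 -> a (sh i 1) = 3^-1 ->
  a (sh i 2) = 3^-1 -> a (sh i 3) = 0 -> a (sh i 4) = 0 ->
  exists n1 n3 n4 : 'I_3,
   [/\ congZ (alpha i) (n1%:R / 3%:R - n3%:R / 3%:R),
       congZ (alpha (sh i 1)) (n1%:R / 3%:R),
       congZ (alpha (sh i 2)) (n1%:R / 3%:R + n4%:R / 3%:R),
       congZ (alpha (sh i 3)) (n3%:R / 3%:R)
     & congZ (alpha (sh i 4)) (- (n4%:R / 3%:R))].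
Proof.
move=> a0 a1 a2 a3 a4; have [E1 E2 E3 E4] := alt_sh a i.
have [Z1 Z2 Z3 Z4] := alt_sh z i.
have z1 : z (sh i 1) = - (z i + z (sh i 2) + z (sh i 3) + z (sh i 4)).
  by apply/subr0_eq; rewrite -sum_z (sum_sh i); ring.
(* With these values of a, the parameters at i + 1, i + 3 and i + 4 are one third of 1 - alt z (sh i
   1), z (sh i 3) and - z (sh i 4). For the other two, the sum of z being 0 makes the discrepancy
   divisible by 3. *)
have [n1 [q1 n1E]] := int_residue F 2 (1 - alt z (sh i 1)).
have [n3 [q3 n3E]] := int_residue F 2 (z (sh i 3)).
have [n4 [q4 n4E]] := int_residue F 2 (z (sh i 4)).
exists n1, n3, n4; rewrite /congZ !alphaE n1E n3E n4E.
rewrite E1 E2 E3 E4 Z1 Z2 Z3 Z4 /alt a0 a1 a2 a3 a4 z1.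
split.
- by exists (z (sh i 2) + z (sh i 4) + q1 - q3); field.
- by exists q1; field.
- by exists (- z i - z (sh i 3) + q1 + q4); field.
- by exists q3; field.
- by exists (- q4); field.
Qed.

Lemma typeC_congruences i : (forall j, a j = 5^-1) ->
  exists n1 n2 n3 : 'I_5,
   [/\ congZ (alpha i)
         (n1%:R / 5%:R + (2 * n2)%:R / 5%:R + (3 * n3)%:R / 5%:R),
       congZ (alpha (sh i 1))
         (n1%:R / 5%:R + (2 * n2)%:R / 5%:R + n3%:R / 5%:R),
       congZ (alpha (sh i 2)) (n1%:R / 5%:R),
       congZ (alpha (sh i 3)) (n1%:R / 5%:R + n2%:R / 5%:R)
     & congZ (alpha (sh i 4)) (n1%:R / 5%:R + n3%:R / 5%:R)].
Proof.
move=> aE; have [Z1 Z2 Z3 Z4] := alt_sh z i.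
have z2 : z (sh i 2) = - (z i + z (sh i 1) + z (sh i 3) + z (sh i 4)).
  by apply/subr0_eq; rewrite -sum_z (sum_sh i); ring.
have alt_a j : alt a j = 0 by rewrite /alt !aE; ring.
(* Every parameter is now (1 - alt z j) / 5. So n1 comes from the one at i + 2, and n2, n3 from the
   differences of those at i + 3 and i + 4 with it; the first two congruences then follow from the
   sum of z being 0. *)
have [n1 [q1 n1E]] := int_residue F 4 (1 - alt z (sh i 2)).
have [n2 [q2 n2E]] := int_residue F 4 (alt z (sh i 2) - alt z (sh i 3)).
have [n3 [q3 n3E]] := int_residue F 4 (alt z (sh i 2) - alt z (sh i 4)).
exists n1, n2, n3; rewrite /congZ !alphaE !alt_a !aE !natrM n1E n2E n3E.
rewrite Z1 Z2 Z3 Z4 /alt z2; split.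
- exists (- z i - 2 * z (sh i 3) + z (sh i 4) + q1 + 2 * q2 + 3 * q3).
  by field.
- by exists (z (sh i 1) + z (sh i 4) + q1 + 2 * q2 + q3); field.
- by exists q1; field.
- by exists (q1 + q2); field.
- by exists (q1 + q3); field.
Qed.

End Types.

Theorem theorem2p2 (R : realType) (alpha : 'I_5 -> R[i])
    (f : 'I_5 -> {fraction {poly R[i]}}) :
  A4_rational_solution alpha f ->
  [/\ (typeA f -> forall j : 'I_5, is_int (alpha j)),
      (typeB f -> exists i : 'I_5, exists n1 n3 n4 : 'I_3,
         [/\ congZ (alpha i) (n1%:R / 3%:R - n3%:R / 3%:R),
             congZ (alpha (sh i 1)) (n1%:R / 3%:R),
             congZ (alpha (sh i 2)) (n1%:R / 3%:R + n4%:R / 3%:R),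
             congZ (alpha (sh i 3)) (n3%:R / 3%:R)
           & congZ (alpha (sh i 4)) (- (n4%:R / 3%:R))]) &
      (typeC f -> exists i : 'I_5, exists n1 n2 n3 : 'I_5,
         [/\ congZ (alpha i)
               (n1%:R / 5%:R + (2 * n2)%:R / 5%:R + (3 * n3)%:R / 5%:R),
             congZ (alpha (sh i 1))
               (n1%:R / 5%:R + (2 * n2)%:R / 5%:R + n3%:R / 5%:R),
             congZ (alpha (sh i 2)) (n1%:R / 5%:R),
             congZ (alpha (sh i 3)) (n1%:R / 5%:R + n2%:R / 5%:R)
           & congZ (alpha (sh i 4)) (n1%:R / 5%:R + n3%:R / 5%:R)])].
Proof.
move=> /A4_asymptotics[a [z [sum_a aP sum_z alphaE poleP]]].
have regular j : ~ pole_at_infty (f j) -> a j = 0.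
  by move=> reg; apply/eqP/negPn/negP => /poleP.
split.
- case=> i tA; apply: (alpha_int alphaE); case: tA => [[_ reg]|].
    by apply: (typeA1_int sum_a (i := i)) => j /reg/regular.
  move=> [/poleP p0 /poleP p1 /poleP p3 /regular a2 /regular a4].
  exact: (typeA2_int sum_a aP p0 p1 p3 a2 a4).
- case=> i [/poleP p0 /poleP p1 _ /regular a3 /regular a4].
  have [a0 a1 a2] := typeB_values sum_a aP p0 p1 a3 a4.
  by exists i; apply: (typeB_congruences sum_z alphaE).
(* For Type C the congruences hold at every index, so 0 serves. *)
- move=> poles; exists 0; apply: (typeC_congruences sum_z alphaE).
  by apply: (typeC_values sum_a aP) => j; apply/poleP.
Qed.
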